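(* Let the pairs $\{(X_i,Y_i): i\in D^{cal}\cup D^{test}\}$ be exchangeable, and let the fitted scores $S^1,\dots,S^K$ follow the $K$-class mixture model described in the context. Assume there exists $\boldsymbol{x_0}=(x_1,\dots,x_K)$ such that the $K\times K$ matrix $$F(\boldsymbol{x_0})=\begin{pmatrix}F^1_1(x_1)&F^1_2(x_2)&\cdots&F^1_K(x_K)\\ F^2_1(x_1)&F^2_2(x_2)&\cdots&F^2_K(x_K)\\ \vdots&\vdots&&\vdots\\ F^K_1(x_1)&F^K_2(x_2)&\cdots&F^K_K(x_K)\end{pmatrix}$$ has rank $K$. Then, for a given level $\alpha$, the selective classification rule $$\hat Y_j=\Big(\arg\max_{i\in\{1,\dots,K\}} S^i(X_j)\Big)\cdot\mathbb I(\hat R_j\le\alpha),\qquad j\in D^{test},$$ with the R-values $\hat R_j$ defined in the context, controls the false selection rate at level $\alpha$, i.e. $$\mathrm{FSR}=\mathbb E\left\{\frac{\sum_{j\in D^{test}}\mathbb I(\hat Y_j\ne Y_j,\hat Y_j\ne0)}{\big(\sum_{j\in D^{test}}\mathbb I(\hat Y_j\neq0)\big)\vee1}\right\}\le\alpha .$$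
   Context: Selective $K$-class classification. Samples are pairs $(X,Y)$ with $X\in\mathbb R^p$ and true class $Y\in\{1,\dots,K\}$. Labeled data $D$ are randomly split into $D^{train}$ and $D^{cal}$ (the latter of size $n^{cal}$); $D^{test}$ is a test set of size $n^{test}$ with unobserved labels. A prediction $0$ means ''indecision''. A black-box model trained only on $D^{train}$ yields score functions $S^1(x),\dots,S^K(x)$ for the $K$ classes. Let $\hat S_i=\max\{S^1(X_i),\dots,S^K(X_i)\}$. Write $a\vee b=\max(a,b)$. Mixture model: $S^j\sim\pi_1F^j_1+\pi_2F^j_2+\dots+\pi_KF^j_K$ for $j=1,\dots,K$, where $\pi_k$ is the proportion of class $k$ and $F^j_k$ is the conditional CDF of the score $S^j$ given class $k$. For a threshold $t$ define $$\hat Q(t)=\frac{\frac1{n^{cal}+1}\Big\{\sum_{i\in D^{cal}}\mathbb I\big(\hat S_i\ge t,\ \arg\max_{k} S^k(X_i)\ne Y_i\big)+1\Big\}}{\frac1{n^{test}}\Big\{\big(\sum_{j\in D^{test}}\mathbb I(\hat S_j\ge t)\big)\vee1\Big\}},$$ and for $j\in D^{test}$ the R-value $\hat R_j=\inf_{t\le\hat S_j}\hat Q(t)$. *)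

(* Defs.v *)
From HB Require Import structures.
From mathcomp Require Import all_boot all_order all_algebra perm.
From mathcomp Require Import all_classical all_reals all_analysis.
Set Implicit Arguments.
Unset Strict Implicit.
Unset Printing Implicit Defensive.
Import Order.TTheory GRing.Theory Num.Theory.
Import numFieldNormedType.Exports.
Local Open Scope classical_set_scope.
Local Open Scope ring_scope.

(* The K classes are the natural numbers 1, ..., K, and 0 is indecision. Score
   functions and mixture components are indexed by 'I_K, index k standing for
   class k.+1. *)

Section rule.
Context {R : realType} {V : Type} (K : nat) (K_gt0 : (0 < K)%N).
Variable s : 'I_K -> V -> R.

Definition top_score (x : V) : R :=
  \big[Num.max/s (Ordinal K_gt0) x]_(k < K) s k x.

(* Ties are broken by the fixed rule built into [arg max]. *)
Definition top_class (x : V) : nat :=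
  ([arg max_(k > Ordinal K_gt0) s k x]%O : 'I_K).+1.

(* A sample z consists of ncal calibration pairs (indices lshift _ i) followed
   by ntest test pairs (indices rshift _ j). *)
Variables (ncal ntest : nat) (z : 'I_(ncal + ntest) -> V * nat).

Definition cal (i : 'I_ncal) : V * nat := z (lshift ntest i).
Definition test (j : 'I_ntest) : V * nat := z (rshift ncal j).

Definition Qhat (t : R) : R :=
  (ncal.+1%:R^-1 *
     (\sum_(i < ncal) ((t <= top_score (cal i).1)%R &&
                       (top_class (cal i).1 != (cal i).2)) + 1)%:R) /
  (ntest%:R^-1 *
     (maxn (\sum_(j < ntest) (t <= top_score (test j).1)%R) 1)%:R).

Definition Rvalue (j : 'I_ntest) : R :=
  inf [set Qhat t | t in [set t | t <= top_score (test j).1]].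

Definition Yhat (alpha : R) (j : 'I_ntest) : nat :=
  (top_class (test j).1 * (Rvalue j <= alpha)%R)%N.

Definition FSP (alpha : R) : R :=
  (\sum_(j < ntest) ((Yhat alpha j != (test j).2) && (Yhat alpha j != 0)))%:R /
  (maxn (\sum_(j < ntest) (Yhat alpha j != 0)) 1)%:R.

End rule.

Section model.
Context {d dT : measure_display} {Omega : measurableType d}
  {T : measurableType dT} {R : realType} (P : probability Omega R).

(* Exchangeability of (Z_i)_i given the training data: the joint law of
   (train, Z_0, ..., Z_(n-1)) is invariant under permutations of the Z_i. When
   train is constant this is plain exchangeability of (Z_i)_i. *)
Definition exchangeable_given {dE} {E : measurableType dE} (n : nat)
    (train : Omega -> T) (Z : 'I_n -> Omega -> E) : Prop :=
  forall (u : 'S_n) (A : set (T * n.-tuple E)), measurable A ->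
    pushforward P (fun w => (train w, [tuple Z (u i) w | i < n])) A =
    pushforward P (fun w => (train w, [tuple Z i w | i < n])) A.

(* pi k is the proportion of class k.+1, and F j k is the conditional CDF of
   the j-th score given class k.+1; the latter is written without dividing by
   pi k, so that it is unconstrained when pi k = 0. *)
Definition mixture_model {dV} {V : measurableType dV} (K n : nat)
    (train : Omega -> T) (S : T -> 'I_K -> V -> R)
    (X : 'I_n -> Omega -> V) (Y : 'I_n -> Omega -> nat)
    (pi : 'I_K -> R) (F : 'I_K -> 'I_K -> cumulativeBounded (0 : R) (1 : R)) :
    Prop :=
  forall i : 'I_n,
  [/\ forall k : 'I_K, P [set w | Y i w = k.+1] = (pi k)%:E,
      forall (j k : 'I_K) x,
        P [set w | S (train w) j (X i w) <= x /\ Y i w = k.+1] =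
        (pi k * F j k x)%:E
    & forall (j : 'I_K) x,
        P [set w | S (train w) j (X i w) <= x] =
        (\sum_(k < K) pi k * F j k x)%:E].

End model.

(* Main.v *)
(* Write the FSP as the sum over test points j of the share
   [j selected and wrong] / max(#selected, 1), and average each share over the
   m + 1 exchanges of j with itself or with one of the m calibration points. Let I
   be the set of those m + 1 points that are selected and wrong once placed at
   position j, and t0 the least of their witness thresholds (t below the score of
   the point with Qhat t <= alpha). An error at position j scoring at least t0
   makes up for the "+1" in the numerator of Qhat t0, so Qhat t0 is the same
   whichever k in I sits at position j, hence at most alpha for all of them. As
   I is contained in the errors scoring at least t0, this gives
   n |I| <= alpha (m + 1) #selected after each such exchange. So each share has
   mean at most alpha / n, by exchangeability. *)
Require Import Defs.
From HB Require Import structures.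
From mathcomp Require Import all_boot all_order all_algebra perm.
From mathcomp Require Import all_classical all_reals all_analysis.
From mathcomp Require Import measurable_realfun ring.
Set Implicit Arguments.
Unset Strict Implicit.
Unset Printing Implicit Defensive.
Import Order.TTheory GRing.Theory Num.Theory.
Import numFieldNormedType.Exports.
Local Open Scope classical_set_scope.
Local Open Scope ring_scope.

(** * Selection by thresholding an empirical ratio, for fixed scores and error flags *)

Section swap.
Context {R : realType} (m n : nat).
Implicit Types (sc : 'I_(m + n) -> R) (err : 'I_(m + n) -> bool) (j : 'I_n).

(** [Qhat] in terms of bare scores and error flags, so that exchanging points is mere precomposition
    with a permutation. *)
Definition score_ratio sc err (t : R) : R :=
  (m.+1%:R^-1 *
     (\sum_(i < m) ((t <= sc (lshift n i))%R && err (lshift n i)) + 1)%:R) /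
  (n%:R^-1 * (maxn (\sum_(j < n) (t <= sc (rshift m j))%R) 1)%:R).

(* Thresholds may be taken among the observed scores, where the ratio depends
   only on the relative order of the scores. *)
Definition selected sc err (alpha : R) j : bool :=
  [exists k, (sc k <= sc (rshift m j)) && (score_ratio sc err (sc k) <= alpha)].

Definition share sc err (alpha : R) j : R :=
  (selected sc err alpha j && err (rshift m j))%:R /
  (maxn (\sum_(i < n) selected sc err alpha i) 1)%:R.

Lemma score_ratio_eq sc sc' err err' t t' :
    (forall k, (t <= sc k) = (t' <= sc' k)) -> err =1 err' ->
  score_ratio sc err t = score_ratio sc' err' t'.
Proof.
move=> le_eq err_eq; rewrite /score_ratio.
by congr (_ * (_ + _)%:R / (_ * (maxn _ _)%:R));
  apply: eq_bigr => i _; rewrite le_eq ?err_eq.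
Qed.

(** The least score that is at least [t] works: no score lies strictly below it and at or above [t],
    so every count is unchanged. *)
Lemma score_ratio_at_score sc err t k0 : t <= sc k0 ->
  exists2 k, t <= sc k <= sc k0 & score_ratio sc err (sc k) = score_ratio sc err t.
Proof.
move=> tk0; case: (@arg_minP _ _ _ k0 (fun k => t <= sc k) sc) => // k tk kmin.
exists k; first by rewrite tk kmin.
apply: score_ratio_eq => // l; apply/idP/idP => [|/kmin //].
exact: le_trans.
Qed.

Lemma selectedP sc err alpha j :
  reflect (exists2 t, t <= sc (rshift m j) & score_ratio sc err t <= alpha)
          (selected sc err alpha j).
Proof.
apply: (iffP existsP) => [[k /andP[]]|[t tj ta]]; first by exists (sc k).
by have [k /andP[_ kj] kE] := score_ratio_at_score err tj; exists k; rewrite kj kE.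
Qed.

Lemma score_ratio_ge0 sc err t : 0 <= score_ratio sc err t.
Proof. by rewrite !(mulr_ge0, invr_ge0). Qed.

(** The infimum is attained, since by [score_ratio_at_score] the ratio takes only its finitely many
    values at observed scores; a bound on it thus yields an actual witness threshold. *)
Lemma inf_score_ratio_le sc err alpha j :
  (inf [set score_ratio sc err t | t in [set t | t <= sc (rshift m j)]] <= alpha)
  = selected sc err alpha j.
Proof.
set E := [set _ | _ in _]; apply/idP/selectedP => [Ea|[t tj ta]]; last first.
  apply: le_trans ta; apply: ge_inf; last by exists t.
  by exists 0 => _ [u _ <-]; exact: score_ratio_ge0.
case: (@arg_minP _ _ _ (rshift m j) (fun k => sc k <= sc (rshift m j))
        (fun k => score_ratio sc err (sc k))) => // k kj kmin.
exists (sc k) => //; apply: le_trans Ea; apply: lb_le_inf.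
  by exists (score_ratio sc err (sc k)), (sc k).
move=> _ [t /= tj <-].
by have [l /andP[_ lj] <-] := score_ratio_at_score err tj; exact: kmin.
Qed.

Lemma share_ge0 sc err alpha j : 0 <= share sc err alpha j.
Proof. by rewrite mulr_ge0 ?invr_ge0. Qed.

Definition cal_test j : {set 'I_(m + n)} :=
  rshift m j |: [set lshift n i | i : 'I_m].

(** * Exchanging one test point with the calibration points *)

Section swap_with_test.
Variables (sc : 'I_(m + n) -> R) (err : 'I_(m + n) -> bool) (j : 'I_n).

Let u k := tperm (rshift m j) k.
Let calj := cal_test j.

Lemma card_calj : #|calj| = m.+1.
Proof.
rewrite /calj /cal_test cardsU1 card_imset ?card_ord; last exact: lshift_inj.
by case: imsetP => // -[i _ /eqP]; rewrite eq_rlshift.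
Qed.

Lemma sum_calj (f : 'I_(m + n) -> nat) :
  (\sum_(k in calj) f k = \sum_(i < m) f (lshift n i) + f (rshift m j))%N.
Proof.
rewrite /calj /cal_test big_setU1 /=; last first.
  by apply/imsetP => -[i _ /eqP]; rewrite eq_rlshift.
by rewrite addnC big_imset //= => i i' _ _; exact: lshift_inj.
Qed.

Lemma tperm_calj k i : k \in calj -> (u k i \in calj) = (i \in calj).
Proof.
move=> kG; rewrite /u; case: tpermP => [->|->|//]; rewrite kG;
by rewrite /calj /cal_test !inE eqxx.
Qed.

Lemma tperm_test k i : k \in calj -> i != j -> u k (rshift m i) = rshift m i.
Proof.
move=> kG ij; rewrite /u tpermD // ?eq_rshift 1?eq_sym //.
apply: contraTneq kG => <-; rewrite /calj /cal_test !inE eq_rshift (negPf ij) /=.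
by apply/imsetP => -[l _ /eqP]; rewrite eq_rlshift.
Qed.

(* If an error k of calj scoring at least t is put at test position j, the
   "+1" of the numerator accounts for k. *)
Lemma score_ratio_tperm k t : k \in calj -> err k -> t <= sc k ->
  score_ratio (sc \o u k) (err \o u k) t =
  (m.+1%:R^-1 * (\sum_(i in calj) ((t <= sc i)%R && err i))%:R) /
  (n%:R^-1 * (\sum_(i < n | i != j) (t <= sc (rshift m i))%R + 1)%:R).
Proof.
move=> kG kerr tk; rewrite /score_ratio /=.
have uj : u k (rshift m j) = k by rewrite /u tpermL.
congr (_ * _%:R / (_ * _%:R)).
  (* The [+1] is the term of position [j], so the numerator sums over all of [calj], which the
     transposition [u k] maps to itself. *)
  pose f i : nat := (t <= sc (u k i)) && err (u k i).
  have -> : 1%N = f (rshift m j) by rewrite /f uj tk kerr.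
  rewrite -(sum_calj f) [RHS](reindex_inj (@perm_inj _ (u k))) /=.
  by apply: eq_bigl => i; rewrite tperm_calj.
(* Position [j] now holds [k], which scores at least [t]: the count is at least 1 and [maxn] returns
   it. *)
rewrite (bigD1 j) //= uj tk addnC !addn1 maxnSS maxn0; congr _.+1.
apply: eq_bigr => i ij; by rewrite tperm_test.
Qed.

(** Only the set [I] of the proof contributes; [size_le] bounds each of its [#|I|] terms by a
    fraction [1 / #|I|] of the right-hand side. *)
Lemma sum_share_tperm (alpha : R) : 0 <= alpha ->
  \sum_(k in calj) share (sc \o u k) (err \o u k) alpha j
    <= m.+1%:R * (alpha / n%:R).
Proof.
move=> a0.
pose sel k := selected (sc \o u k) (err \o u k) alpha.
pose D k := (\sum_(i < n) sel k i)%N.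
pose I : {set 'I_(m + n)} := [set k in calj | sel k j && err k].
have uj k : u k (rshift m j) = k by rewrite /u tpermL.
have selj k : k \in I -> (0 < D k)%N.
  by rewrite inE => /and3P[_ kj _]; rewrite /D (bigD1 j) //= kj.
have n0 : (0 < n)%N by case: n j => // -[].
case: (pickP (mem I)) => [k0 /= k0I|I0]; last first.
  rewrite big1 ?mulr_ge0 ?invr_ge0 // => k kG.
  have := I0 k; rewrite /= inE kG /share /= uj -/(sel k j) => ->.
  by rewrite mul0r.
(* The implication makes the statement hold for every [k], with dummy threshold 0 outside [I], so
   that [choice] gives a function. *)
have wit k : exists t, (k \in I) ==> (t <= sc k) &&
    (score_ratio (sc \o u k) (err \o u k) t <= alpha).
  case: (boolP (k \in I)) => [|_]; last by exists 0.
  rewrite inE => /and3P[_ /selectedP[t]]; rewrite /= uj => tk ta _.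
  by exists t; rewrite tk ta.
have [t tP] := choice wit.
case: (@arg_minP _ _ _ k0 (fun k => k \in I) t k0I) => k1 /= k1I tmin.
have t1P k : k \in I -> t k1 <= sc k.
  by move=> kI; have := tP k; rewrite kI => /andP[+ _]; apply: le_trans; exact: tmin.
have ratio1 k : k \in I -> score_ratio (sc \o u k) (err \o u k) (t k1) <= alpha.
  move=> kI; have := tP k1; rewrite k1I => /andP[_]; apply: le_trans.
  have := k1I; rewrite inE => /and3P[k1G _ k1err].
  have := kI; rewrite inE => /and3P[kG _ kerr].
  (* The closed form does not mention the exchanged point, so the ratios for [k] and for [k1] agree
     at [t k1]. *)
  by rewrite !score_ratio_tperm ?t1P.
have size_le k : k \in I -> #|I|%:R * n%:R <= alpha * m.+1%:R * (D k)%:R.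
  move=> kI; have := ratio1 k kI.
  have := kI; rewrite inE => /and3P[kG _ kerr].
  rewrite score_ratio_tperm ?t1P //; set V := (\sum_(i in calj) _)%N.
  set W := (_ + 1)%N => ra.
  have IV : (#|I| <= V)%N.
    rewrite -sum1_card /V big_mkcond [leqRHS]big_mkcond /=; apply: leq_sum => i _.
    case: ifP => // iI; have := iI; rewrite inE => /and3P[-> _ ->].
    by rewrite t1P.
  (* The [+1] in [W] stands for [j], which is selected. Any other test point scoring at least [t k1]
     stays in place under [u k] and is selected with witness [t k1]. *)
  have WD : (W <= D k)%N.
    have kj : sel k j by move: kI; rewrite inE => /and3P[_ ->].
    rewrite /W /D [leqRHS](bigD1 j) //= kj addnC leq_add2l.
    apply: leq_sum => i ij; case: leP => // ti.
    rewrite (_ : sel k i) //; apply/selectedP; exists (t k1); last exact: ratio1.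
    suff -> : (sc \o u k) (rshift m i) = sc (rshift m i) by [].
    by rewrite /= tperm_test.
  have W_gt0 : (0 < W)%N by rewrite /W addn1.
  move: ra; rewrite ler_pdivrMr ?mulr_gt0 ?invr_gt0 ?ltr0n //.
  rewrite ler_pdivrMl ?ltr0n // => le1.
  apply: (@le_trans _ _ (V%:R * n%:R)); first by rewrite ler_wpM2r ?ler_nat.
  apply: (@le_trans _ _ (alpha * m.+1%:R * W%:R)).
    rewrite -ler_pdivlMr ?ltr0n // (le_trans le1) // le_eqVlt; apply/orP; left.
    by apply/eqP; ring.
  by rewrite ler_wpM2l ?mulr_ge0 // ler_nat.
have I_gt0 : (0 < #|I|)%N by apply/card_gt0P; exists k0.
have -> : m.+1%:R * (alpha / n%:R)
    = \sum_(k in I) m.+1%:R * (alpha / n%:R) / #|I|%:R :> R.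
  by rewrite sumr_const -[RHS]mulr_natr mulfVK // pnatr_eq0 -lt0n.
rewrite big_mkcond [leRHS]big_mkcond /=; apply: ler_sum => k _.
have [kI|kI] := boolP (k \in I); last first.
  case: ifP => // kG; move: kI; rewrite inE kG /share /= uj /sel => /negbTE ->.
  by rewrite mul0r.
have := kI; rewrite inE => /and3P[-> kj kerr].
rewrite /share /= uj -/(sel k j) kj kerr mul1r.
have Dk : (0 < D k)%N := selj _ kI.
rewrite (maxn_idPl _) // -[(\sum_(i < n) _)%N]/(D k).
rewrite ler_pdivlMr ?ltr0n // mulrC ler_pdivrMr ?ltr0n // mulrA mulrAC.
by rewrite ler_pdivlMr ?ltr0n // [_ * alpha]mulrC size_le.
Qed.

End swap_with_test.
End swap.

(** * The false selection proportion as a sum of shares *)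

Lemma FSP_share {R : realType} {V : Type} (K ncal ntest : nat)
    (K_gt0 : (0 < K)%N) (s : 'I_K -> V -> R)
    (z : 'I_(ncal + ntest) -> V * nat) (alpha : R) :
  FSP K_gt0 s z alpha =
  \sum_(j < ntest) share (fun i => top_score K_gt0 s (z i).1)
    (fun i => top_class K_gt0 s (z i).1 != (z i).2) alpha j.
Proof.
pose sc i := top_score K_gt0 s (z i).1.
pose err i := top_class K_gt0 s (z i).1 != (z i).2.
have RE j : (Rvalue K_gt0 s z j <= alpha) = selected sc err alpha j.
  exact: inf_score_ratio_le.
have YE j : Yhat K_gt0 s z alpha j =
    (top_class K_gt0 s (test z j).1 * selected sc err alpha j)%N.
  by rewrite /Yhat RE.
(* [top_class] is a successor, so a prediction 0 can only come from non-selection. *)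
have Y0 j : (Yhat K_gt0 s z alpha j != 0%N) = selected sc err alpha j.
  by rewrite YE muln_eq0 /=; case: selected.
rewrite /FSP /share -mulr_suml -natr_sum; congr (_%:R / (maxn _ _)%:R).
  apply: eq_bigr => j _; rewrite Y0 YE andbC.
  by case: selected; rewrite ?muln1.
by apply: eq_bigr => j _; rewrite Y0.
Qed.

(** * Measurability through finitely many comparisons *)

Section measurability.
Context {d : measure_display} {E : measurableType d}.

(** [P] is a finite union of cells on which every [b i] is constant. *)
Lemma measurable_determined (I : finType) (b : I -> E -> bool) (P : set E) :
    (forall i, measurable_fun [set: E] (b i)) ->
    (forall x y, (forall i, b i x = b i y) -> P x -> P y) ->
  measurable P.
Proof.
move=> mb bP.
have -> : P = \bigcup_(f in [set f : {ffun I -> bool} |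
      exists2 x, P x & forall i, b i x = f i])
    \bigcap_(i in [set: I]) (b i @^-1` [set f i]).
  apply/seteqP; split=> [x Px|y [f [x Px xf] yf]].
    exists [ffun i => b i x]; first by exists x => // i; rewrite ffunE.
    by move=> i _; rewrite /= ffunE.
  by apply: bP Px => i; rewrite xf yf.
apply: fin_bigcup_measurable; first exact: finite_finset.
move=> f _; apply: fin_bigcap_measurable; first exact: finite_finset.
by move=> i _; rewrite -[X in measurable X]setTI; exact: mb.
Qed.

Context {R : realType} (K : nat) (K_gt0 : (0 < K)%N) (s : 'I_K -> E -> R).
Hypothesis s_meas : forall k, measurable_fun [set: E] (s k).

Lemma measurable_top_score : measurable_fun [set: E] (top_score K_gt0 s).
Proof.
rewrite /top_score; elim: (index_enum _) => [|k r IH].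
  by under eq_fun do rewrite big_nil; exact: s_meas.
by under eq_fun do rewrite big_cons; exact: measurable_maxr.
Qed.

Lemma measurable_top_class_neq (y : E -> nat) : measurable_fun [set: E] y ->
  measurable_fun [set: E] (fun x => top_class K_gt0 s x != y x).
Proof.
move=> my; apply: (measurable_fun_bool true); rewrite setTI.
(* The comparisons fix the arg max; since [top_class] lies between 1 and [K], it suffices to test
   [y] against these values. *)
pose b (i : 'I_K * 'I_K + 'I_K) x :=
  match i with inl kl => s kl.1 x <= s kl.2 x | inr k => y x == k.+1 end.
apply: (@measurable_determined _ b) => [[[k l]|k]|x x' bE].
- exact: measurable_fun_ler.
- apply: (measurable_fun_bool true) => /=.
  rewrite (_ : _ @^-1` _ = y @^-1` [set k.+1]); first exact: my.
  by apply/seteqP; split=> x /= /eqP.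
rewrite /preimage /=.
have top_eq : [arg max_(k > Ordinal K_gt0) s k x]%O
    = [arg max_(k > Ordinal K_gt0) s k x']%O :> 'I_K.
  rewrite /Order.arg_max /extremum; congr odflt; apply: eq_pick => k /=.
  by apply: eq_forallb => l; exact: (bE (inl (l, k))).
suff -> : (top_class K_gt0 s x != y x) = (top_class K_gt0 s x' != y x') by [].
rewrite /top_class top_eq eq_sym [in RHS]eq_sym; congr (~~ _); exact: (bE (inr _)).
Qed.

(** A share depends only on the error flags and the order of the scores, that is, on finitely many
    measurable booleans. *)
Lemma measurable_share (m n : nat) (sc : E -> 'I_(m + n) -> R)
    (err : E -> 'I_(m + n) -> bool) (alpha : R) (j : 'I_n) :
    (forall i, measurable_fun [set: E] (sc ^~ i)) ->
    (forall i, measurable_fun [set: E] (err ^~ i)) ->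
  measurable_fun [set: E] (fun x => share (sc x) (err x) alpha j).
Proof.
move=> msc merr _ B mB; rewrite setTI.
pose b (i : 'I_(m + n) * 'I_(m + n) + 'I_(m + n)) x :=
  match i with inl kl => sc x kl.1 <= sc x kl.2 | inr k => err x k end.
apply: (@measurable_determined _ b) => [[[k l]|k]|x x' bE].
- exact: measurable_fun_ler.
- exact: merr.
have selE i : selected (sc x) (err x) alpha i = selected (sc x') (err x') alpha i.
  apply: eq_existsb => k; rewrite [_ <= _](bE (inl (_, _))); congr (_ && (_ <= _)).
  by apply: score_ratio_eq => l; [exact: (bE (inl (k, l)))|exact: (bE (inr l))].
rewrite /preimage /= (_ : share _ _ _ _ = share (sc x') (err x') alpha j) //.
rewrite /share selE [err x _](bE (inr _)); congr (_ / (maxn _ _)%:R).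
by apply: eq_bigr => i _; rewrite selE.
Qed.

End measurability.

(** * Averaging over exchanges in expectation *)

(** Both sides integrate [f] against the joint law of training data and sample, which a permutation
    leaves unchanged. *)
Lemma ge0_integral_exchangeable {d dT dE : measure_display}
    {Omega : measurableType d} {T : measurableType dT} {E : measurableType dE}
    {R : realType} (P : probability Omega R) (n : nat)
    (train : Omega -> T) (Z : 'I_n -> Omega -> E) (u : 'S_n)
    (f : T * n.-tuple E -> \bar R) :
    measurable_fun [set: Omega] train ->
    (forall i, measurable_fun [set: Omega] (Z i)) ->
    exchangeable_given P train Z ->
    measurable_fun [set: T * n.-tuple E] f -> (forall a, 0 <= f a)%E ->
  (\int[P]_w f (train w, [tuple Z (u i) w | i < n]) =
   \int[P]_w f (train w, [tuple Z i w | i < n]))%E.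
Proof.
move=> mtrain mZ exchZ mf f0.
have mW (v : 'S_n) : measurable_fun [set: Omega]
    (fun w => (train w, [tuple Z (v i) w | i < n])).
  apply: measurable_fun_pair => //; apply/measurable_fun_tnthP => i.
  rewrite [X in measurable_fun _ X](_ : _ = Z (v i)) //.
  by apply/funext => w /=; rewrite tnth_mktuple.
have intE (v : 'S_n) :
    (\int[P]_w f (train w, [tuple Z (v i) w | i < n]) =
     \int[pushforward P (fun w => (train w, [tuple Z (v i) w | i < n]))]_a f a)%E.
  by rewrite (ge0_integral_pushforward (mW v)) ?preimage_setT.
(* The identity permutation puts the right-hand side in the form of [intE]. *)
transitivity (\int[P]_w f (train w, [tuple Z ((1 : 'S_n)%g i) w | i < n]))%E.
  rewrite !intE; apply: eq_measure_integral => A mA _.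
  by rewrite /= !exchZ.
apply: eq_integral => w _; congr (f (_, _)).
by apply: eq_from_tnth => i; rewrite !tnth_mktuple perm1.
Qed.

Theorem theorem7 (d dT : measure_display) (Omega : measurableType d)
  (T : measurableType dT) (R : realType) (P : probability Omega R)
  (p K ncal ntest : nat) (K_gt0 : (0 < K)%N)
  (train : {RV P >-> T})
  (X : 'I_(ncal + ntest) -> {RV P >-> p.-tuple R})
  (Y : 'I_(ncal + ntest) -> {RV P >-> nat})
  (Y_class : forall i w, (1 <= Y i w <= K)%N)
  (S : T -> 'I_K -> p.-tuple R -> R)
  (S_meas : forall k,
    measurable_fun [set: T * p.-tuple R] (fun a => S a.1 k a.2))
  (XY_exch : exchangeable_given P train (fun i w => (X i w, Y i w)))
  (pi : 'I_K -> R) (F : 'I_K -> 'I_K -> cumulativeBounded (0 : R) (1 : R))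
  (S_mixture : mixture_model P train S X Y pi F)
  (F_rank : exists x0 : 'I_K -> R,
    \rank (\matrix_(j < K, k < K) F j k (x0 k)) = K)
  (alpha : R) (alpha_ge0 : 0 <= alpha) :
  ('E_P[fun w => FSP K_gt0 (S (train w)) (fun i => (X i w, Y i w)) alpha]
   <= alpha%:E)%E.
Proof.
pose V := p.-tuple R; pose n := (ncal + ntest)%N.
pose Z (i : 'I_n) w := (X i w, Y i w).
have mZ i : measurable_fun [set: Omega] (Z i).
  by apply: measurable_fun_pair.
pose sc (a : T * n.-tuple (V * nat)) i := top_score K_gt0 (S a.1) (tnth a.2 i).1.
pose err (a : T * n.-tuple (V * nat)) i :=
  top_class K_gt0 (S a.1) (tnth a.2 i).1 != (tnth a.2 i).2.
have msample i : measurable_fun [set: T * n.-tuple (V * nat)] (fun a => tnth a.2 i).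
  exact: (measurableT_comp (measurable_tnth i) measurable_snd).
have mS i k : measurable_fun [set: T * n.-tuple (V * nat)]
    (fun a => S a.1 k (tnth a.2 i).1).
  pose g (a : T * n.-tuple (V * nat)) := (a.1, (tnth a.2 i).1).
  suff mg : measurable_fun setT g by exact: (measurableT_comp (S_meas k) mg).
  apply: measurable_fun_pair => //.
  exact: (measurableT_comp measurable_fst (msample i)).
have mH j : measurable_fun [set: T * n.-tuple (V * nat)]
    (fun a => share (sc a) (err a) alpha j).
  apply: measurable_share => i.
    exact: (measurable_top_score K_gt0 (mS i)).
  apply: (measurable_top_class_neq K_gt0 (mS i)).
  exact: (measurableT_comp measurable_snd (msample i)).
pose H j (u : 'S_n) w := share (sc (train w, [tuple Z (u i) w | i < n]))
  (err (train w, [tuple Z (u i) w | i < n])) alpha j.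
(* The score and flag of a point depend only on that point and the training data, so permuting the
   sample permutes them, as [sum_share_tperm] requires. *)
have HE j (u : 'S_n) w : H j u w = share (sc (train w, [tuple Z i w | i < n]) \o u)
    (err (train w, [tuple Z i w | i < n]) \o u) alpha j.
  by congr share; apply/funext => i /=; rewrite /sc /err !tnth_mktuple.
have mHu j (u : 'S_n) : measurable_fun [set: Omega] (H j u).
  apply: (measurableT_comp (mH j)).
  apply: measurable_fun_pair => //; apply/measurable_fun_tnthP => i.
  rewrite [X in measurable_fun _ X](_ : _ = Z (u i)) //.
  by apply/funext => w /=; rewrite tnth_mktuple.
have H_ge0 j u w : (0 <= (H j u w)%:E)%E by rewrite lee_fin share_ge0.
have exchH j (u : 'S_n) :
    (\int[P]_w (H j u w)%:E = \int[P]_w (H j (1 : 'S_n)%g w)%:E)%E.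
  have mf : measurable_fun setT (fun a => (share (sc a) (err a) alpha j)%:E).
    by apply/measurable_EFinP; exact: mH.
  have f0 a : (0 <= (share (sc a) (err a) alpha j)%:E)%E.
    by rewrite lee_fin share_ge0.
  rewrite (ge0_integral_exchangeable u _ mZ XY_exch mf f0) //.
  by rewrite -(ge0_integral_exchangeable 1%g _ mZ XY_exch mf f0).
have int_share j : (\int[P]_w (H j (1 : 'S_n)%g w)%:E <= (alpha / ntest%:R)%:E)%E.
  rewrite -(@lee_pmul2l _ (ncal.+1%:R)%:E) ?lte_fin ?ltr0n // -EFinM.
  pose G := enum (cal_test ncal j).
  (* By exchangeability, each of the [ncal + 1] copies of the integral can be replaced by the one
     for a different exchange with [j]. *)
  have -> : (ncal.+1%:R%:E * \int[P]_w (H j (1 : 'S_n)%g w)%:E =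
      \sum_(k <- G) \int[P]_w (H j (tperm (rshift ncal j) k) w)%:E)%E.
    under eq_bigr do rewrite exchH.
    by rewrite big_enum /= sumr_const card_calj mule_natl.
  rewrite -ge0_integral_sum //; last by move=> k; exact/measurable_EFinP.
  under eq_integral do rewrite sumEFin.
  (* As [P] has mass 1, the bound is the integral of a constant, and the comparison becomes the
     pointwise [sum_share_tperm]. *)
  have -> : ((ncal.+1%:R * (alpha / ntest%:R))%:E =
      \int[P]_w (cst (ncal.+1%:R * (alpha / ntest%:R))%:E w))%E.
    rewrite integral_cst //.
    by move: (probability_setT P) => /= ->; rewrite mule1.
  apply: ge0_le_integral => //=.
  - by move=> w _; rewrite lee_fin sumr_ge0 // => k _; rewrite share_ge0.
  - by apply/measurable_EFinP/measurable_sum => k.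
  move=> w _; rewrite lee_fin /G big_enum /=.
  under eq_bigr do rewrite HE.
  exact: sum_share_tperm.
rewrite unlock.
under eq_integral => w _.
  rewrite FSP_share -sumEFin.
  under eq_bigr => j _.
    rewrite (_ : share _ _ _ _ = H j 1%g w); last first.
      by congr share; apply/funext => i; rewrite /sc /err /= tnth_mktuple perm1.
    over.
  over.
rewrite ge0_integral_sum //; last by move=> j; exact/measurable_EFinP.
apply: (@le_trans _ _ (\sum_(j < ntest) (alpha / ntest%:R)%:E)%E).
  by apply: lee_sum => j _; exact: int_share.
rewrite sumEFin lee_fin sumr_const card_ord -[leLHS]mulr_natr.
(* With no test points the left-hand side is 0 and [alpha_ge0] concludes; otherwise the [ntest]
   bounds add up to [alpha]. *)
have [->|n_gt0] := posnP ntest; first by rewrite mulr0.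
by rewrite divfK // pnatr_eq0 -lt0n.
Qed.
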